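(* Let $T$ be an operator semigroup on a set $D$, let $S$ be a $T$-space and let $B\subseteq S$. Let $\mathcal{T}_3$ be the topology on $\operatorname{End}_T(S)$ generated by the subbasis $\{\operatorname{End}_T(S)\setminus H: H\in\operatorname{GSMn}_T(S/B)\}\cup\{\operatorname{End}_T(S)\}$. Let $P_3$ be the set of all topologies on $\operatorname{End}_T(S)$ for which $$\operatorname{GSMn}_T(S/B)=\{M\in\operatorname{SMn}(\operatorname{GMn}_T(S/B)): M\text{ is closed}\},\qquad ( * )$$ and let $Q_3$ be the set of all topologies on $\operatorname{End}_T(S)$ which are finer than (i.e. contain) $\mathcal{T}_3$. Then $P_3\subseteq Q_3$ and the following statements are equivalent: (i) $P_3\neq\emptyset$. (ii) For any intersection $M$ of finite unions of elements of $\operatorname{GSMn}_T(S/B)$, $M\in\operatorname{SMn}(\operatorname{End}_T(S))$ implies $M\in\operatorname{GSMn}_T(S/B)$. (iii) $\mathcal{T}_3\in P_3$ (where $P_3\subseteq Q_3$); that is, $\mathcal{T}_3$ is the coarsest topology on $\operatorname{End}_T(S)$ such that $( * )$ is satisfied. Moreover, if $\operatorname{GSMn}_T(S/B)$ is a complete $\vee$-sublattice of the complete lattice $\operatorname{SMn}(\operatorname{End}_T(S))$, then statements (i), (ii) and (iii) are true.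
   Context: An operator semigroup on a set $D$ is a (possibly empty) set $T$ of functions $D\to D$ closed under composition. For $U\subseteq D$ put $\langle U\rangle_T=\{f(u): f\in T,\ u\in U\}$; a $T$-space is a subset of $D$ of the form $\langle U\rangle_T$. A $T$-morphism from a $T$-space $S$ to a $T$-space is a map $\sigma$ with $\sigma(f(a))=f(\sigma(a))$ for all $a\in S$, $f\in T$; $\operatorname{End}_T(S)$ is the set of $T$-morphisms from $S$ to itself, a monoid under composition. For $K\subseteq S$, $\operatorname{GMn}_T(S/K)=\{\sigma\in\operatorname{End}_T(S):\sigma(b)=b\ \forall b\in K\}$, a submonoid of $\operatorname{End}_T(S)$; $\operatorname{GSMn}_T(S/B)=\{\operatorname{GMn}_T(S/K): B\subseteq K\subseteq S\}$. $\operatorname{SMn}(M)$ denotes the set of all submonoids of a monoid $M$. $\operatorname{SMn}(\operatorname{End}_T(S))$ is a complete lattice under inclusion, the meet of a family being its intersection and the join of a family being the submonoid of $\operatorname{End}_T(S)$ generated by its union. A complete $\vee$-sublattice is a subset closed under arbitrary joins of the ambient lattice. Intersections in (ii) are over nonempty families. The topology generated by a subbasis is the collection of all unions of finite intersections of its members. *)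

(* Defs.v *)
From HB Require Import structures.
From mathcomp Require Import all_boot.
From mathcomp Require Import boolp classical_sets functions cardinality filter.

Set Implicit Arguments.
Unset Strict Implicit.
Unset Printing Implicit Defensive.

Local Open Scope classical_set_scope.

Definition operator_semigroup (D : Type) (T : set (D -> D)) : Prop :=
  forall f g, T f -> T g -> T (f \o g).

Definition tgen (D : Type) (T : set (D -> D)) (U : set D) : set D :=
  [set f u | f in T & u in U].

Definition tspace (D : Type) (T : set (D -> D)) (S : set D) : Prop :=
  exists U : set D, S = tgen T U.

Lemma tspace_closed (D : Type) (T : set (D -> D)) (S : set D) :
  operator_semigroup T -> tspace T S ->
  forall f a, T f -> S a -> S (f a).
Proof.
move=> Tcomp [U ->] f _ Tf [g Tg [u Uu <-]].
by exists (f \o g); [exact: Tcomp | exists u].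
Qed.

(** The equation [sigma (f a) = f (sigma a)], where [sigma] is only defined on
    the subtype [S]: the element [f a] of [S] is given as a [b : S] whose
    underlying point is [f a].  Such a [b] always exists when [S] is a
    [T]-space ([tspace_closed]), and it is unique. *)
Definition tmorphism (D : Type) (T : set (D -> D)) (S S' : set D)
    (sigma : S -> S') : Prop :=
  forall f (a b : S), T f -> val b = f (val a) ->
    val (sigma b) = f (val (sigma a)).

Record tend (D : Type) (T : set (D -> D)) (S : set D) := TEnd {
  tend_fun :> S -> S ;
  tendP : tmorphism T tend_fun }.

Section TEndMonoid.
Variables (D : Type) (T : set (D -> D)) (S : set D).
Local Notation E := (tend T S).

Lemma tend_eq (s t : E) : tend_fun s = tend_fun t -> s = t.
Proof.
case: s t => [s sP] [t tP] /= st; move: tP; rewrite -{}st => tP.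
by rewrite (Prop_irrelevance sP tP).
Qed.

Lemma tend_id_subproof : tmorphism T (@id S).
Proof. by []. Qed.

Lemma tend_comp_subproof (s t : E) : tmorphism T (s \o t).
Proof. by move=> f a b Tf ba; apply: tendP => //; exact: tendP. Qed.

Definition tend_id : E := TEnd tend_id_subproof.
Definition tend_comp (s t : E) : E := TEnd (tend_comp_subproof s t).

Lemma tend_compA : associative tend_comp.
Proof. by move=> r s t; exact: tend_eq. Qed.

Lemma tend_comp1l : left_id tend_id tend_comp.
Proof. by move=> s; exact: tend_eq. Qed.

Lemma tend_compl1 : right_id tend_id tend_comp.
Proof. by move=> s; exact: tend_eq. Qed.

HB.instance Definition _ := gen_eqMixin E.
HB.instance Definition _ := gen_choiceMixin E.
HB.instance Definition _ :=
  isMonoid.Build E tend_compA tend_comp1l tend_compl1.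

End TEndMonoid.

(** The submonoids of a submonoid [N] of [G], as subsets of [G]; the submonoids
    of [G] itself are [SMn [set: G]]. *)
Definition SMn (G : monoidType) (N : set G) : set (set G) :=
  [set M | M `<=` N /\ monoid_closed [in M]].

(** The join, in the lattice of submonoids of [G], of a family [F]. *)
Definition SMn_join (G : monoidType) (F : set (set G)) : set G :=
  smallest (SMn [set: G]) (\bigcup_(M in F) M).

Definition complete_join_sublattice (G : monoidType) (L : set (set G)) : Prop :=
  L `<=` SMn [set: G] /\ (forall F, F `<=` L -> L (SMn_join F)).

Definition GMn (D : Type) (T : set (D -> D)) (S K : set D) : set (tend T S) :=
  [set sigma | forall b : S, K (val b) -> sigma b = b].
Arguments GMn {D} T S K _.

Definition GSMn (D : Type) (T : set (D -> D)) (S B : set D) :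
    set (set (tend T S)) :=
  [set GMn T S K | K in [set K | B `<=` K /\ K `<=` S]].
Arguments GSMn {D} T S B _.

(** The axioms are those of the factory [isOpenTopological]; topologies are
    handled here as families of open sets because they are compared for
    inclusion.  The empty set is open by the last clause with [F = set0]. *)
Definition is_topology (X : Type) (tau : set (set X)) : Prop :=
  [/\ tau setT,
      setI_closed tau
    & forall F, F `<=` tau -> tau (\bigcup_(A in F) A)].

Definition generated_topology (X : choiceType) (b : set (set X)) :
    set (set X) :=
  [set \bigcup_(A in F) A | F in [set F | F `<=` finI_from b id]].

Definition coarsest_in (X : Type) (P : set (set (set X))) (tau : set (set X)) :
    Prop :=
  P tau /\ (forall tau', P tau' -> tau `<=` tau').

Definition finite_unions (X : Type) (C : set (set X)) : set (set X) :=
  [set \bigcup_(A in F) A | F in [set F | finite_set F /\ F `<=` C]].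

Definition nonempty_intersections (X : Type) (C : set (set X)) : set (set X) :=
  [set \bigcap_(A in F) A | F in [set F | F !=set0 /\ F `<=` C]].

Definition T3 (D : Type) (T : set (D -> D)) (S B : set D) :
    set (set (tend T S)) :=
  generated_topology ([set ~` H | H in GSMn T S B] `|` [set setT]).
Arguments T3 {D} T S B _.

Definition P3 (D : Type) (T : set (D -> D)) (S B : set D) :
    set (set (set (tend T S))) :=
  [set tau | is_topology tau /\
     GSMn T S B = [set M | SMn (GMn T S B) M /\ tau (~` M)]].
Arguments P3 {D} T S B _.

Definition Q3 (D : Type) (T : set (D -> D)) (S B : set D) :
    set (set (set (tend T S))) :=
  [set tau | is_topology tau /\ T3 T S B `<=` tau].
Arguments Q3 {D} T S B _.

(* Main.v *)
Require Import Defs.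
From mathcomp Require Import all_boot finmap.
From mathcomp Require Import boolp classical_sets functions cardinality filter.

Local Open Scope classical_set_scope.

(** The topological half holds for any family [C] of sets.  The closed sets of
    the topology generated by the complements of the members of [C] are the
    intersections of finite unions of members of [C]
    ([capcup_closed], [generated_closed_capcup]).  Hence in every topology for
    which the members of [GSMn T S B] are closed, and so in every member of
    [P3], each nonempty intersection [M] of finite unions of members is closed;
    such an [M] lies inside [GMn T S B], the largest member.  So [stmt_ii]
    is necessary for [P3] to be nonempty, and it says exactly that [T3] has no
    closed submonoid of [GMn T S B] outside [GSMn T S B].  As each topology in
    [P3] contains the subbasis of [T3], it contains [T3].

    The algebraic half, when joins of members are members, rests on the
    endomorphisms having individual fixed sets: the endomorphisms fixing
    everything that [sigma] fixes form the smallest member of [GSMn T S B]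
    containing [sigma] ([GMn_fixed_sub]).  If [sigma] belongs to an
    intersection [M] of unions of members, then this smallest member is included
    in [M].  So [M] is the union of the members that it includes, and when [M]
    is a submonoid it is also their join. *)

(** * Topologies as families of open sets *)

Lemma topology_bigcap_finite (X : Type) (tau : set (set X)) (F : set (set X)) :
  is_topology tau -> finite_set F -> F `<=` tau -> tau (\bigcap_(A in F) A).
Proof.
case=> tauT tauI _ /finite_fsetP[E ->] Etau; rewrite bigcap_fset big_seq.
by apply: big_ind => // A AE; exact: Etau.
Qed.

Lemma generated_topologyP (X : choiceType) (b : set (set X)) (A : set X) :
  generated_topology b A <->
  forall x, A x -> exists U, [/\ finI_from b id U, U x & U `<=` A].
Proof.
split=> [[F Fb <-] x [U FU Ux]|Anbhs].
  by exists U; split=> // [|y Uy]; [exact: Fb | exists U].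
exists [set U | finI_from b id U /\ U `<=` A] => [U []//|].
apply/seteqP; split=> [x [U [_ UA] /UA]//|x /Anbhs[U [bU Ux UA]]].
by exists U.
Qed.

Lemma generated_topology_is_topology (X : choiceType) (b : set (set X)) :
  is_topology (generated_topology b).
Proof.
split=> [|A A' /generated_topologyP Ab /generated_topologyP A'b|F Fb].
- by exists (finI_from b id); rewrite ?finI_from_cover.
- apply/generated_topologyP => x [/Ab[U [bU Ux UA]] /A'b[U' [bU' Ux' UA']]].
  by exists (U `&` U'); split; [exact: finI_fromI | split | exact: setISS].
- apply/generated_topologyP => x [A FA Ax].
  have /generated_topologyP/(_ x Ax)[U [bU Ux UA]] := Fb _ FA.
  by exists U; split=> // y /UA Ay; exists A.
Qed.

Lemma generated_topology_sub (X : choiceType) (b : set (set X)) :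
  b `<=` generated_topology b.
Proof.
move=> A bA; apply/generated_topologyP => x Ax.
by exists A; split=> //; exact: (@finI_from1 _ _ _ id).
Qed.

Lemma generated_topology_min (X : choiceType) (b tau : set (set X)) :
  is_topology tau -> b `<=` tau -> generated_topology b `<=` tau.
Proof.
move=> tautop btau _ [F Fb <-]; case: (tautop) => _ _; apply=> U /Fb[E Eb <-].
apply: topology_bigcap_finite tautop (finite_fset E) _ => A AE.
by apply: btau; rewrite -in_setE; exact: Eb.
Qed.

(** * Closed sets and intersections of finite unions *)

Lemma finite_unions_closed (X : Type) (tau C : set (set X)) :
  is_topology tau -> (forall A, C A -> tau (~` A)) ->
  forall A, finite_unions C A -> tau (~` A).
Proof.
move=> tautop Ctau _ [F [Ffin FC] <-]; rewrite setC_bigcup.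
rewrite -(bigcap_image F setC id).
apply: topology_bigcap_finite => //; first exact: finite_image.
by move=> _ [A FA <-]; apply/Ctau/FC.
Qed.

Lemma capcup_closed (X : Type) (tau C : set (set X)) :
  is_topology tau -> (forall A, C A -> tau (~` A)) ->
  forall M, nonempty_intersections (finite_unions C) M -> tau (~` M).
Proof.
move=> tautop Ctau _ [F [_ FC] <-]; rewrite setC_bigcap.
rewrite -(bigcup_image F setC id).
case: (tautop) => _ _; apply=> _ [A FA <-].
by apply: finite_unions_closed tautop Ctau _ (FC _ FA).
Qed.

(** A basic open set is a finite intersection of complements of members of [C]
    and of copies of the whole space; the latter contribute empty sets to the
    union that is its complement, and can be dropped. *)
Lemma setC_finI_from_finite_unions (X : choiceType) (C : set (set X)) U :
  finI_from ([set ~` H | H in C] `|` [set setT]) id U ->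
  finite_unions C (~` U).
Proof.
case=> E EC <-; rewrite setC_bigcap.
exists (C `&` setC @` [set` E]).
  by split=> [|A []//]; apply/finite_setIr/finite_image/finite_fset.
apply/seteqP; split=> [x [_ [_ [A EA <-]] Ax]|x [A EA Ax]]; first by exists A.
have : ([set ~` H | H in C] `|` [set setT]) A by rewrite -in_setE; exact: EC.
case=> [[H CH HA]|AT]; last by case: Ax; rewrite AT.
by exists (~` A) => //; split; [rewrite -HA setCK | exists A].
Qed.

(** The whole space is closed but need not be a nonempty intersection of finite
    unions of members of [C]; for a closed set included in a member [N] of [C],
    adding [N] to the family makes the intersection nonempty. *)
Lemma generated_closed_capcup (X : choiceType) (C : set (set X)) (N M : set X) :
  C N -> M `<=` N ->
  generated_topology ([set ~` H | H in C] `|` [set setT]) (~` M) ->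
  nonempty_intersections (finite_unions C) M.
Proof.
move=> CN MN [F Fb FM].
exists ([set ~` U | U in F] `|` [set N]).
  split; first by exists N; right.
  move=> _ [[U FU <-]|->]; first by apply/setC_finI_from_finite_unions/Fb.
  exists [set N]; last exact: bigcup_set1.
  by split; [exact: finite_set1 | move=> _ ->].
rewrite bigcap_setU bigcap_set1 bigcap_image -setC_bigcup FM setCK.
exact: setIidl.
Qed.

(** * Pointwise stabilisers in the endomorphism monoid *)

Section Stabilisers.
Context {D : Type} {T : set (D -> D)} {S B : set D}.

Lemma GMnS (K K' : set D) : K `<=` K' -> GMn T S K' `<=` GMn T S K.
Proof. by move=> KK' s sK' b /KK'/sK'. Qed.

Lemma SMn_GMn (K : set D) : B `<=` K -> SMn (GMn T S B) (GMn T S K).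
Proof.
move=> BK; split; first exact: GMnS.
split=> [|s t]; rewrite !inE // => sK tK b Kb.
exact: etrans (congr1 s (tK b Kb)) (sK b Kb).
Qed.

Lemma GSMn_SMn (H : set (tend T S)) : GSMn T S B H -> SMn (GMn T S B) H.
Proof. by case=> K [BK _] <-; exact: SMn_GMn. Qed.

Lemma GSMn_top : B `<=` S -> GSMn T S B (GMn T S B).
Proof. by move=> BS; exists B => //; split. Qed.

Lemma capcup_GSMn_sub (M : set (tend T S)) :
  nonempty_intersections (finite_unions (GSMn T S B)) M -> M `<=` GMn T S B.
Proof.
case=> F [[A FA] FG] <- s /(_ _ FA).
have [G [_ GG] <-] := FG _ FA.
by case=> H GH; have [HB _] := GSMn_SMn _ (GG _ GH); exact: HB.
Qed.

Definition fixed_points (s : tend T S) : set D :=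
  [set val b | b in [set b | s b = b]].

Lemma GMn_fixed_points (s : tend T S) : GMn T S (fixed_points s) s.
Proof. by move=> b [c sc /val_inj <-]. Qed.

Lemma GSMn_fixed_points (s : tend T S) :
  B `<=` S -> GMn T S B s -> GSMn T S B (GMn T S (fixed_points s)).
Proof.
move=> BS sB; exists (fixed_points s) => //; split=> [d Bd|_ [b _ <-]].
  pose b : S := exist _ d (mem_set (BS _ Bd)).
  by exists b => //; exact: sB.
exact: set_valP.
Qed.

(** A stabiliser [GMn T S K] contains [s] exactly when [s] fixes [K], so the
    stabiliser of the fixed points of [s] is the least stabiliser containing
    [s]. *)
Lemma GMn_fixed_sub (H : set (tend T S)) (s : tend T S) :
  GSMn T S B H -> H s -> GMn T S (fixed_points s) `<=` H.
Proof.
case=> K [_ KS] <- sK; apply: GMnS => d Kd.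
pose b : S := exist _ d (mem_set (KS _ Kd)).
by exists b => //; exact: sK.
Qed.

Lemma GMn_fixed_sub_capcup (M : set (tend T S)) (s : tend T S) :
  nonempty_intersections (finite_unions (GSMn T S B)) M -> M s ->
  GMn T S (fixed_points s) `<=` M.
Proof.
case=> F [_ FG] <- Ms t st A FA.
have := Ms _ FA; have [G [_ GG] <-] := FG _ FA.
by case=> H GH Hs; exists H => //; exact: GMn_fixed_sub (GG _ GH) Hs _ st.
Qed.

Lemma complete_join_capcup_GSMn (M : set (tend T S)) :
  B `<=` S -> complete_join_sublattice (GSMn T S B) ->
  nonempty_intersections (finite_unions (GSMn T S B)) M ->
  SMn [set: tend T S] M -> GSMn T S B M.
Proof.
move=> BS [_ joinG] Mcap Msub.
pose F := [set H | GSMn T S B H /\ H `<=` M].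
suff -> : M = SMn_join F by apply: joinG => H [].
apply/seteqP; split.
  move=> s Ms; apply: sub_gen_smallest.
  exists (GMn T S (fixed_points s)); last exact: GMn_fixed_points.
  split; last exact: GMn_fixed_sub_capcup.
  by apply: GSMn_fixed_points => //; exact: capcup_GSMn_sub Mcap _ Ms.
by apply: smallest_sub => // s [H [_ HM] /HM].
Qed.

(** * The topologies whose closed submonoids are the stabilisers *)

Lemma P3_GSMn_closed (tau : set (set (tend T S))) (H : set (tend T S)) :
  P3 T S B tau -> GSMn T S B H -> tau (~` H).
Proof. by case=> _ -> []. Qed.

Lemma P3_sub_Q3 : P3 T S B `<=` Q3 T S B.
Proof.
move=> tau tauP; have [tautop _] := tauP; split=> //.
apply: generated_topology_min => // _ [[H GH <-]|->].
  exact: P3_GSMn_closed.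
by case: tautop.
Qed.

Lemma P3_capcup_GSMn (tau : set (set (tend T S))) (M : set (tend T S)) :
  P3 T S B tau -> nonempty_intersections (finite_unions (GSMn T S B)) M ->
  SMn [set: tend T S] M -> GSMn T S B M.
Proof.
move=> tauP Mcap [_ Mmon]; have [tautop ->] := tauP; split.
  by split=> //; exact: capcup_GSMn_sub.
by apply: capcup_closed tautop _ _ Mcap => A; exact: P3_GSMn_closed.
Qed.

Lemma capcup_GSMn_P3 :
  B `<=` S ->
  (forall M, nonempty_intersections (finite_unions (GSMn T S B)) M ->
     SMn [set: tend T S] M -> GSMn T S B M) ->
  P3 T S B (T3 T S B).
Proof.
move=> BS capG; split; first exact: generated_topology_is_topology.
apply/seteqP; split=> [H GH|M [[MB Mmon] Mclosed]].
  split; first exact: GSMn_SMn.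
  by apply: generated_topology_sub; left; exists H.
apply: capG; last by split.
exact: generated_closed_capcup (GSMn_top BS) MB Mclosed.
Qed.

End Stabilisers.

Theorem theorem5p3p2 (D : Type) (T : set (D -> D)) (S B : set D)
    (hT : operator_semigroup T) (hS : tspace T S) (hB : B `<=` S) :
  let stmt_i := P3 T S B !=set0 in
  let stmt_ii :=
    forall M : set (tend T S),
      nonempty_intersections (finite_unions (GSMn T S B)) M ->
      SMn [set: tend T S] M -> GSMn T S B M in
  let stmt_iii := P3 T S B (T3 T S B) in
  [/\ P3 T S B `<=` Q3 T S B,
      stmt_i <-> stmt_ii,
      stmt_ii <-> stmt_iii,
      stmt_iii <-> coarsest_in (P3 T S B) (T3 T S B)
    & complete_join_sublattice (GSMn T S B) -> [/\ stmt_i, stmt_ii & stmt_iii]].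
Proof.
move=> stmt_i stmt_ii stmt_iii.
have i_ii : stmt_i -> stmt_ii by case=> tau tauP M; exact: P3_capcup_GSMn tauP.
have ii_iii : stmt_ii -> stmt_iii by exact: capcup_GSMn_P3.
have iii_i : stmt_iii -> stmt_i by move=> T3P; exists (T3 T S B).
split.
- exact: P3_sub_Q3.
- by split=> [|/ii_iii/iii_i].
- by split=> [|/iii_i/i_ii].
- by split=> [T3P|[]//]; split=> // tau /P3_sub_Q3[].
- move=> joinG.
  have ii : stmt_ii by move=> M; exact: complete_join_capcup_GSMn.
  by split=> //; [exact/iii_i/ii_iii | exact: ii_iii].
Qed.
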